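(* Let $P$ be the doubly infinite tridiagonal stochastic matrix with entries $P_{n,n+1}=a_n$, $P_{n,n}=b_n$, $P_{n,n-1}=c_n$ ($n\in\mathbb{Z}$), where $a_n+b_n+c_n=1$, $b_n\ge 0$, $0<a_n,c_n<1$ for all $n\in\mathbb{Z}$. Let $$H=1-\cfrac{a_0}{1-\cfrac{c_1}{1-\cfrac{a_1}{1-\cfrac{c_2}{1-\cdots}}}},\qquad H'=\cfrac{c_0}{1-\cfrac{a_{-1}}{1-\cfrac{c_{-1}}{1-\cfrac{a_{-2}}{1-\cdots}}}}$$ with convergents $h_n=A_n/B_n$ and $h'_{-n}=A'_{-n}/B'_{-n}$, $n\ge 0$, where $A_n,B_n,A'_{-n},B'_{-n}$ are the canonical numerators and denominators specified in the context. Assume that $$0<A_n<B_n\quad\text{and}\quad 0<A'_{-n}<B'_{-n},\qquad n\ge 1.$$ Then both continued fractions $H$ and $H'$ converge. Moreover, let $P=\widetilde P_L\widetilde P_U$ be the LU factorization of $P$ with free parameter $\tilde r_0$ (described in the context), and assume that $H'\le H$. Then both $\widetilde P_L$ and $\widetilde P_U$ are stochastic matrices if and only if $\tilde r_0$ is chosen in the range $$H'\le \tilde r_0\le H.$$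
   Context: All matrices are indexed by $\mathbb{Z}\times\mathbb{Z}$. $P$ is the transition matrix of an irreducible random walk on $\mathbb{Z}$. A matrix is stochastic if its entries are nonnegative and each row sums to $1$. Convergents. The numbers $A_n,B_n$ are given by $A_{-1}=1$, $A_0=1$, $B_{-1}=0$, $B_0=1$ and $A_{2n}=A_{2n-1}-c_nA_{2n-2}$, $B_{2n}=B_{2n-1}-c_nB_{2n-2}$ for $n\ge1$; $A_{2n+1}=A_{2n}-a_nA_{2n-1}$, $B_{2n+1}=B_{2n}-a_nB_{2n-1}$ for $n\ge0$. The numbers $A'_{-n},B'_{-n}$ are given by $A'_1=-1$, $A'_0=0$, $B'_1=0$, $B'_0=1$ and $A'_{-2n}=A'_{-2n+1}-a_{-n}A'_{-2n+2}$, $B'_{-2n}=B'_{-2n+1}-a_{-n}B'_{-2n+2}$ for $n\ge1$; $A'_{-2n-1}=A'_{-2n}-c_{-n}A'_{-2n+1}$, $B'_{-2n-1}=B'_{-2n}-c_{-n}B'_{-2n+1}$ for $n\ge0$. The values $H$ and $H'$ are the limits $\lim_{n\to\infty}h_n$ and $\lim_{n\to\infty}h'_{-n}$. LU factorization. $\widetilde P_L$ is lower bidiagonal with $(\widetilde P_L)_{n,n}=\tilde s_n$, $(\widetilde P_L)_{n,n-1}=\tilde r_n$, and $\widetilde P_U$ is upper bidiagonal with $(\widetilde P_U)_{n,n}=\tilde y_n$, $(\widetilde P_U)_{n,n+1}=\tilde x_n$, all other entries being $0$, where $\tilde r_n+\tilde s_n=1$ and $\tilde y_n+\tilde x_n=1$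 for all $n\in\mathbb{Z}$. The identity $P=\widetilde P_L\widetilde P_U$ means $a_n=\tilde s_n\tilde x_n$, $b_n=\tilde r_n\tilde x_{n-1}+\tilde s_n\tilde y_n$, $c_n=\tilde r_n\tilde y_{n-1}$ for $n\in\mathbb{Z}$. Given the real number $\tilde r_0$, all the coefficients are computed recursively: for nonnegative indices in the order $\tilde s_0,\tilde x_0,\tilde y_0,\tilde r_1,\tilde s_1,\tilde x_1,\tilde y_1,\tilde r_2,\dots$ (i.e. $\tilde s_n=1-\tilde r_n$, $\tilde x_n=a_n/\tilde s_n$, $\tilde y_n=1-\tilde x_n$, $\tilde r_{n+1}=c_{n+1}/\tilde y_n$), and for negative indices in the order $\tilde y_{-1},\tilde x_{-1},\tilde s_{-1},\tilde r_{-1},\tilde y_{-2},\dots$ (i.e. $\tilde y_{n-1}=c_n/\tilde r_n$, $\tilde x_{n-1}=1-\tilde y_{n-1}$, $\tilde s_{n-1}=a_{n-1}/\tilde x_{n-1}$, $\tilde r_{n-1}=1-\tilde s_{n-1}$). Saying that $\widetilde P_L,\widetilde P_U$ are stochastic includes that all these coefficients are well defined and nonnegative. *)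

(* Defs.v *)
From HB Require Import structures.
From mathcomp Require Import all_boot all_order all_algebra.
From mathcomp Require Import all_classical all_reals all_analysis.
Set Implicit Arguments.
Unset Strict Implicit.
Unset Printing Implicit Defensive.
Import Order.TTheory GRing.Theory Num.Theory.
Import numFieldNormedType.Exports.
Local Open Scope classical_set_scope.
Local Open Scope ring_scope.

(* Matrices indexed by Z x Z are functions int -> int -> R. *)

Definition stochastic (R : realType) (M : int -> int -> R) : Prop :=
  (forall i j, 0 <= M i j) /\
  (forall i, (\esum_(j in [set: int]) (M i j)%:E = 1)%E).

(* The sum is a finite-support sum, with value 0 when infinitely many terms are
   nonzero; for the bidiagonal factors below there are at most two such terms. *)
Definition mulmxZ (R : realType) (M N : int -> int -> R) (i j : int) : R :=
  \sum_(k \in [set: int]) (M i k * N k j).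

Definition tridiagonal (R : realType) (a b c : int -> R) (i j : int) : R :=
  if j == i + 1 then a i else if j == i then b i
  else if j == i - 1 then c i else 0.

Definition lower_bidiagonal (R : realType) (s r : int -> R) (i j : int) : R :=
  if j == i then s i else if j == i - 1 then r i else 0.

Definition upper_bidiagonal (R : realType) (y x : int -> R) (i j : int) : R :=
  if j == i then y i else if j == i + 1 then x i else 0.

(* The pair (X_(n-1), X_n) for X_(-1) = u, X_0 = v and
   X_(n+1) = X_n - q_n * X_(n-1), n >= 0. *)
Fixpoint three_term (R : realType) (q : nat -> R) (u v : R) (n : nat) : R * R :=
  if n is m.+1 then
    let X := three_term q u v m in (X.2, X.2 - q m * X.1)
  else (u, v).

(* The coefficients a_0, c_1, a_1, c_2, ... of H. *)
Definition qH (R : realType) (a c : int -> R) (m : nat) : R :=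
  if odd m then c (m./2.+1)%:Z else a (m./2)%:Z.

(* The coefficients c_0, a_(-1), c_(-1), a_(-2), ... of H'. *)
Definition qH' (R : realType) (a c : int -> R) (m : nat) : R :=
  if odd m then a (- (m./2.+1)%:Z) else c (- (m./2)%:Z).

Definition cfA (R : realType) (a c : int -> R) (n : nat) : R :=
  (three_term (qH a c) 1 1 n).2.

Definition cfB (R : realType) (a c : int -> R) (n : nat) : R :=
  (three_term (qH a c) 0 1 n).2.

(* The primed quantities at n : nat are those of index -n; the first initial
   value is the one at index 1. *)
Definition cfA' (R : realType) (a c : int -> R) (n : nat) : R :=
  (three_term (qH' a c) (- 1) 0 n).2.

Definition cfB' (R : realType) (a c : int -> R) (n : nat) : R :=
  (three_term (qH' a c) 0 1 n).2.

Definition cfh (R : realType) (a c : int -> R) (n : nat) : R :=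
  cfA a c n / cfB a c n.

Definition cfh' (R : realType) (a c : int -> R) (n : nat) : R :=
  cfA' a c n / cfB' a c n.

Record LUcoef (R : realType) : Type :=
  MkLU { LUr : R; LUs : R; LUy : R; LUx : R }.

(* The coefficients of index n. *)
Fixpoint LU_nonneg (R : realType) (a c : int -> R) (r0 : R) (n : nat) :
    LUcoef R :=
  let r := if n is m.+1 then c n%:Z / LUy (LU_nonneg a c r0 m) else r0 in
  let s := 1 - r in
  let x := a n%:Z / s in
  let y := 1 - x in
  MkLU r s y x.

(* The coefficients of index -(n+1), computed from r of index -n. *)
Fixpoint LU_neg (R : realType) (a c : int -> R) (r0 : R) (n : nat) : LUcoef R :=
  let r' := if n is m.+1 then LUr (LU_neg a c r0 m) else r0 in
  let y := c (- n%:Z) / r' in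
  let x := 1 - y in
  let s := a (- n.+1%:Z) / x in
  let r := 1 - s in
  MkLU r s y x.

Definition LU_coef (R : realType) (a c : int -> R) (r0 : R) (n : int) :
    LUcoef R :=
  match n with
  | Posz m => LU_nonneg a c r0 m
  | Negz m => LU_neg a c r0 m
  end.

Definition rt (R : realType) (a c : int -> R) (r0 : R) (n : int) : R :=
  LUr (LU_coef a c r0 n).
Definition st (R : realType) (a c : int -> R) (r0 : R) (n : int) : R :=
  LUs (LU_coef a c r0 n).
Definition yt (R : realType) (a c : int -> R) (r0 : R) (n : int) : R :=
  LUy (LU_coef a c r0 n).
Definition xt (R : realType) (a c : int -> R) (r0 : R) (n : int) : R :=
  LUx (LU_coef a c r0 n).

Definition PL (R : realType) (a c : int -> R) (r0 : R) : int -> int -> R :=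
  lower_bidiagonal (st a c r0) (rt a c r0).

Definition PU (R : realType) (a c : int -> R) (r0 : R) : int -> int -> R :=
  upper_bidiagonal (yt a c r0) (xt a c r0).

(* No division by 0 occurs in the recursion: division being total, this has to
   be required explicitly. *)
Definition LU_well_defined (R : realType) (a c : int -> R) (r0 : R) : Prop :=
  (forall n : int, 0 <= n -> st a c r0 n != 0 /\ yt a c r0 n != 0) /\
  (forall n : int, n <= 0 -> rt a c r0 n != 0 /\ xt a c r0 (n - 1) != 0).

(* For a, b, c with a_n + b_n + c_n = 1 the second condition follows from the
   first one. *)
Definition LU_factorization (R : realType) (a b c : int -> R) (r0 : R) : Prop :=
  LU_well_defined a c r0 /\
  (forall i j, tridiagonal a b c i j = mulmxZ (PL a c r0) (PU a c r0) i j).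

(* Main.v *)
Require Import Defs.
From HB Require Import structures.
From mathcomp Require Import all_boot all_order all_algebra.
From mathcomp Require Import all_classical all_reals all_analysis.
From mathcomp Require Import ring lra zify.
Import Order.TTheory GRing.Theory Num.Theory.
Import numFieldNormedType.Exports.
Local Open Scope classical_set_scope.
Local Open Scope ring_scope.

(** Both halves of the recursion for the coefficients are instances of
    rho_(k+1) = 1 - q_k / rho_k: with q the coefficients of H and
    rho_0 = 1 - r_0, or with q the coefficients of H' and rho_0 = r_0.
    Setting rho_k = N_k / N_(k-1) turns this into the linear recursion
    N_(k+1) = N_k - q_k N_(k-1), so that N_k = A_k - r_0 B_k, respectively
    N_k = r_0 B'_(-k) - A'_(-k). All rho_k are positive iff all N_k are, that
    is, iff h'_(-k) < r_0 < h_k for all k. By the determinant formula h_k is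
    strictly decreasing and h'_(-k) strictly increasing, so these strict
    inequalities amount to H' <= r_0 <= H. *)

(** Strictness costs nothing in the limit: if t is at most the limit, then t <= u_(n+1) < u_n. This
    is applied to h_n and to -h'_(-n). *)
Lemma decreasing_bounded_cvgn (R : realType) (u : nat -> R) (l : R) :
  (forall n, u n.+1 < u n) -> (forall n, l <= u n) ->
  cvgn u /\ forall t, (forall n, t < u n) <-> t <= limn u.
Proof.
move=> u_dec u_lb.
have u_ni : {homo u : n m / (n <= m)%N >-> m <= n}.
  by apply/nonincreasing_seqP => n; exact/ltW.
have u_cvg : cvgn u.
  by apply: nonincreasing_is_cvgn => //; exists l => _ [n _ <-].
split=> // t; split=> [t_lt | t_le n].
  by apply: limr_ge => //; apply: nearW => n; exact/ltW.
apply: le_lt_trans (u_dec n); apply: le_trans t_le _.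
exact: nonincreasing_cvgn_ge.
Qed.

(** * Three-term recursions, their determinant formula and ratios of consecutive terms *)

Section ThreeTerm.
Context {R : realType}.
Implicit Types (q : nat -> R) (t u v : R).

Lemma three_term_fst q u v n :
  (three_term q u v n).1 = if n is m.+1 then (three_term q u v m).2 else u.
Proof. by case: n. Qed.

Lemma three_term_lin q k t u v u' v' n :
  (three_term q (k * u + t * u') (k * v + t * v') n).2 =
  k * (three_term q u v n).2 + t * (three_term q u' v' n).2.
Proof.
suff: three_term q (k * u + t * u') (k * v + t * v') n =
  (k * (three_term q u v n).1 + t * (three_term q u' v' n).1,
   k * (three_term q u v n).2 + t * (three_term q u' v' n).2) by move=> ->.
elim: n => [|n IHn] //=.
by rewrite IHn /=; congr pair; ring.
Qed.

(** Substituting the recursion shows that each step multiplies the determinant of two solutions by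
    [q n]. *)
Lemma three_term_det q u v u' v' n :
  (three_term q u v n).2 * (three_term q u' v' n).1
    - (three_term q u v n).1 * (three_term q u' v' n).2 =
  (\prod_(i < n) q i) * (v * u' - u * v').
Proof.
elim: n => [|n IHn] /=; first by rewrite big_ord0 mul1r.
by rewrite big_ord_recr /= mulrAC -IHn; ring.
Qed.

(** After cross-multiplication, the determinant formula gives the difference of consecutive
    convergents as [- u] times a product of positive [q i]. *)
Lemma convergents_decreasing q u v n : (forall i, 0 < q i) -> 0 < u ->
  (forall m, 0 < (three_term q 0 1 m).2) ->
  (three_term q u v n.+1).2 / (three_term q 0 1 n.+1).2 <
  (three_term q u v n).2 / (three_term q 0 1 n).2.
Proof.
move=> q_gt0 u_gt0 B_gt0.
have := three_term_det q u v 0 1 n.+1.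
rewrite !three_term_fst mulr0 mulr1 sub0r => det_eq.
rewrite ltr_pdivrMr // mulrAC ltr_pdivlMr // -subr_lt0 det_eq.
rewrite mulrN oppr_lt0 mulr_gt0 //.
by apply: prodr_gt0 => i _; exact: q_gt0.
Qed.

Fixpoint cf_ratio q t (n : nat) : R :=
  if n is m.+1 then 1 - q m / cf_ratio q t m else t.

(** As N_(-1) = 1, N_n is the product of rho_0, ..., rho_n, and rho_n = N_n / N_(n-1). With total
    division these relations may fail once a term vanishes, so each direction derives its relation
    from the positivity it assumes. *)
Lemma cf_ratio_gt0P q t :
  (forall n, 0 < cf_ratio q t n) <-> (forall n, 0 < (three_term q 1 t n).2).
Proof.
split=> [rho_gt0 n | N_gt0].
  suff [] : 0 < (three_term q 1 t n).1 /\
      (three_term q 1 t n).2 = cf_ratio q t n * (three_term q 1 t n).1.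
    by move=> N_gt0 ->; rewrite mulr_gt0.
  elim: n => [|n [N_gt0 N_eq]] /=; first by rewrite mulr1.
  have rho_n := rho_gt0 n.
  split; rewrite N_eq; first by rewrite mulr_gt0.
  by field; rewrite gt_eqF.
have N1_gt0 n : 0 < (three_term q 1 t n).1 by rewrite three_term_fst; case: n.
suff rhoE n : cf_ratio q t n = (three_term q 1 t n).2 / (three_term q 1 t n).1.
  by move=> n; rewrite rhoE divr_gt0.
elim: n => [|n IHn] /=; first by rewrite divr1.
rewrite IHn; move: (N_gt0 n) (N1_gt0 n).
by case: three_term => u v /= v_gt0 u_gt0; field; rewrite !gt_eqF.
Qed.

End ThreeTerm.

(** * Sums over the integers with at most two nonzero terms *)

Section TwoEntries.
Context {R : realType}.

Lemma fsbig_two_entries (f : int -> R) (k l : int) : k != l ->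
  (forall j, j != k -> j != l -> f j = 0) ->
  \sum_(j \in [set: int]) f j = f k + f l.
Proof.
move=> kl f0; rewrite -(@fsbig_widen _ _ _ _ ([set k] `|` [set l])) //.
  rewrite fsbigU0 ?fsbig_set1 //.
  by move=> j [/= -> kl']; rewrite kl' eqxx in kl.
move=> j [_ /= /not_orP[jk jl]]; apply: f0; exact/eqP.
Qed.

Lemma esum_two_entries (f : int -> R) (k l : int) : k != l ->
  (forall j, 0 <= f j) -> (forall j, j != k -> j != l -> f j = 0) ->
  (\esum_(j in [set: int]) (f j)%:E = (f k + f l)%:E)%E.
Proof.
move=> kl f_ge0 f0.
have -> : (\esum_(j in [set: int]) (f j)%:E =
           \esum_(j in [set k] `|` [set l]) (f j)%:E)%E.
  rewrite [RHS]esum_mkcond; apply: eq_esum => j _.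
  case: ifPn => // /negP; rewrite inE /= => /not_orP[jk jl].
  by rewrite f0 //; exact/eqP.
rewrite esum_fset //; last by move=> j _; rewrite lee_fin.
  rewrite fsbigU0 ?fsbig_set1 //.
  by move=> j [/= -> kl']; rewrite kl' eqxx in kl.
Qed.

End TwoEntries.

(** * Row sums and products of bidiagonal matrices *)

Section Bidiagonal.
Context {R : realType}.
Implicit Types (a b c r s x y : int -> R).

Lemma lower_bidiagonal_stochastic s r :
  (forall n, 0 <= s n) -> (forall n, 0 <= r n) -> (forall n, r n + s n = 1) ->
  stochastic (lower_bidiagonal s r).
Proof.
move=> s_ge0 r_ge0 rs.
have M_ge0 i j : 0 <= lower_bidiagonal s r i j.
  by rewrite /lower_bidiagonal; do 2?case: ifP.
split=> // i; rewrite (@esum_two_entries _ _ i (i - 1)) //; last 2 first.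
- by lia.
- by move=> j ji ji1; rewrite /lower_bidiagonal (negPf ji) (negPf ji1).
by rewrite /lower_bidiagonal !eqxx ifF ?(addrC (s i)) ?rs //; lia.
Qed.

Lemma upper_bidiagonal_stochastic y x :
  (forall n, 0 <= y n) -> (forall n, 0 <= x n) -> (forall n, y n + x n = 1) ->
  stochastic (upper_bidiagonal y x).
Proof.
move=> y_ge0 x_ge0 yx.
have M_ge0 i j : 0 <= upper_bidiagonal y x i j.
  by rewrite /upper_bidiagonal; do 2?case: ifP.
split=> // i; rewrite (@esum_two_entries _ _ i (i + 1)) //; last 2 first.
- by lia.
- by move=> j ji ji1; rewrite /upper_bidiagonal (negPf ji) (negPf ji1).
by rewrite /upper_bidiagonal !eqxx ifF ?yx //; lia.
Qed.

Lemma mulmxZ_bidiagonal a b c r s x y :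
  (forall n, a n = s n * x n) ->
  (forall n, b n = r n * x (n - 1) + s n * y n) ->
  (forall n, c n = r n * y (n - 1)) ->
  forall i j, tridiagonal a b c i j =
    mulmxZ (lower_bidiagonal s r) (upper_bidiagonal y x) i j.
Proof.
move=> aE bE cE i j.
rewrite /mulmxZ (@fsbig_two_entries _ _ i (i - 1)); last 2 first.
- by lia.
- by move=> k ki ki1; rewrite /lower_bidiagonal (negPf ki) (negPf ki1) mul0r.
rewrite /lower_bidiagonal !eqxx (_ : (i - 1 == i) = false); last by lia.
rewrite /upper_bidiagonal /tridiagonal subrK.
have [->|ji1] := eqVneq j (i + 1).
  do 3?[rewrite ifF; last by lia].
  by rewrite mulr0 addr0.
have [->|ji] := eqVneq j i.
  by rewrite ifF; [rewrite bE addrC | lia].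
have [_|_] := eqVneq j (i - 1); first by rewrite mulr0 add0r.
by rewrite !mulr0 addr0.
Qed.

End Bidiagonal.

(** * The LU coefficients as continued fraction ratios *)

Section LU.
Context {R : realType} (a c : int -> R) (r0 : R).

Lemma qH_double (n : nat) : qH a c n.*2 = a n.
Proof. by rewrite /qH odd_double half_double. Qed.

Lemma qH_doubleS (n : nat) : qH a c n.*2.+1 = c n.+1.
Proof. by rewrite /qH /= odd_double uphalf_double. Qed.

Lemma qH'_double (n : nat) : qH' a c n.*2 = c (- n%:Z).
Proof. by rewrite /qH' odd_double half_double. Qed.

Lemma qH'_doubleS (n : nat) : qH' a c n.*2.+1 = a (- n.+1%:Z).
Proof. by rewrite /qH' /= odd_double uphalf_double. Qed.

Let rho := cf_ratio (qH a c) (1 - r0).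
Let rho' := cf_ratio (qH' a c) r0.

(** The recursion alternates y_n = 1 - a_n / s_n and s_(n+1) = 1 - c_(n+1) / y_n, which consumes
    a_0, c_1, a_1, c_2, ... in the order of H. *)
Lemma st_yt_nonneg (n : nat) :
  st a c r0 n = rho n.*2 /\ yt a c r0 n = rho n.*2.+1.
Proof.
have rhoS k : rho k.+1 = 1 - qH a c k / rho k by [].
elim: n => [|n [_ IHn]]; first by rewrite rhoS (qH_double 0).
have sE : st a c r0 n.+1 = rho n.+1.*2.
  by rewrite doubleS rhoS qH_doubleS -IHn.
by rewrite rhoS qH_double -sE.
Qed.

(** Going down, x_(-n-1) = 1 - c_(-n) / r_(-n) and r_(-n-1) = 1 - a_(-n-1) / x_(-n-1), which
    consumes the coefficients in the order of H'. *)
Lemma rt_xt_neg (n : nat) :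
  rt a c r0 (- n%:Z) = rho' n.*2 /\ xt a c r0 (- n%:Z - 1) = rho' n.*2.+1.
Proof.
have rhoS k : rho' k.+1 = 1 - qH' a c k / rho' k by [].
have NSE (m : nat) : - m%:Z - 1 = Negz m by lia.
elim: n => [|n [_ IHn]]; first by rewrite NSE rhoS (qH'_double 0) !oppr0.
have rE : rt a c r0 (- n.+1%:Z) = rho' n.+1.*2.
  rewrite doubleS rhoS qH'_doubleS -IHn NSE -NegzE /rt /xt /= NegzE.
  by case: n {IHn} => [|m] /=; rewrite -?NegzE.
by split=> //; rewrite NSE rhoS qH'_double -rE /rt /xt /= -!NegzE.
Qed.

Let st_nonneg n := (st_yt_nonneg n).1.
Let yt_nonneg n := (st_yt_nonneg n).2.
Let rt_nonpos n := (rt_xt_neg n).1.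
Let xt_neg n := (rt_xt_neg n).2.

(** The divisors of the recursion are exactly the ratios: even positions give s_n and r_(-n), odd
    ones y_n and x_(-n-1). *)
Lemma LU_well_definedP :
  LU_well_defined a c r0 <->
  (forall n, rho n != 0) /\ (forall n, rho' n != 0).
Proof.
split=> [[h h']|[h h']]; split=> n.
- have [n2|n2] := boolP (odd n).
    rewrite -(odd_double_half n) n2 add1n -yt_nonneg.
    by case: (h n./2).
  rewrite -(odd_double_half n) (negPf n2) add0n -st_nonneg.
  by case: (h n./2).
- have n_le0 : - (n./2)%:Z <= 0 by lia.
  have [n2|n2] := boolP (odd n).
    rewrite -(odd_double_half n) n2 add1n -xt_neg.
    by case: (h' _ n_le0).
  rewrite -(odd_double_half n) (negPf n2) add0n -rt_nonpos.
  by case: (h' _ n_le0).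
- by case: n => // n _; rewrite st_nonneg yt_nonneg.
- move=> n_le0; rewrite (_ : n = - `|n|%N%:Z); last by lia.
  by rewrite rt_nonpos xt_neg.
Qed.

Lemma LU_ge0_ratio :
  (forall n, 0 <= st a c r0 n) -> (forall n, 0 <= yt a c r0 n) ->
  (forall n, 0 <= rt a c r0 n) -> (forall n, 0 <= xt a c r0 n) ->
  (forall n, 0 <= rho n) /\ (forall n, 0 <= rho' n).
Proof.
move=> hs hy hr hx; split=> n; rewrite -(odd_double_half n);
  case: (odd n); rewrite ?add1n ?add0n.
- by rewrite -yt_nonneg.
- by rewrite -st_nonneg.
- by rewrite -xt_neg.
- by rewrite -rt_nonpos.
Qed.

Lemma rt_add_st n : rt a c r0 n + st a c r0 n = 1.
Proof. by case: n => [[|n]|[|n]]; rewrite /rt /st /=; ring. Qed.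

Lemma yt_add_xt n : yt a c r0 n + xt a c r0 n = 1.
Proof. by case: n => [[|n]|[|n]]; rewrite /yt /xt /=; ring. Qed.

Hypotheses (rho_gt0 : forall n, 0 < rho n) (rho'_gt0 : forall n, 0 < rho' n).

(** For n >= 0, x_n is defined as a_n / s_n; for n < 0, s_n is defined as a_n / x_n. The divisor is
    a positive ratio in both cases. *)
Lemma st_mul_xt n : st a c r0 n * xt a c r0 n = a n.
Proof.
case: n => n.
  have s0 : st a c r0 n != 0 by rewrite st_nonneg gt_eqF.
  have -> : xt a c r0 n = a n / st a c r0 n by rewrite /xt /st; case: n {s0}.
  by field.
have x0 : xt a c r0 (Negz n) != 0.
  by rewrite (_ : Negz n = - n%:Z - 1) ?xt_neg ?gt_eqF //; lia.
have -> : st a c r0 (Negz n) = a (Negz n) / xt a c r0 (Negz n).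
  by rewrite /xt /st NegzE; case: n {x0}.
by field.
Qed.

Lemma rt_mul_yt n : rt a c r0 n * yt a c r0 (n - 1) = c n.
Proof.
have nonpos (m : nat) :
    rt a c r0 (- m%:Z) * yt a c r0 (- m%:Z - 1) = c (- m%:Z).
  have r0' : rt a c r0 (- m%:Z) != 0 by rewrite rt_nonpos gt_eqF.
  have -> : yt a c r0 (- m%:Z - 1) = c (- m%:Z) / rt a c r0 (- m%:Z).
    rewrite (_ : - m%:Z - 1 = Negz m); last by lia.
    by rewrite /yt /=; case: m {r0'} => [|m]; rewrite ?oppr0 // -?NegzE.
  by field.
(* Index 0 belongs to the downward recursion: r_0 is the parameter and y_(-1) is computed from it.
   For positive indices r is the quotient instead. *)
case: n => [[|n]|n]; first by have := nonpos 0; rewrite oppr0.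
  rewrite (_ : n.+1%:Z - 1 = n); last by lia.
  have y0 : yt a c r0 n != 0 by rewrite yt_nonneg gt_eqF.
  have -> : rt a c r0 n.+1 = c n.+1 / yt a c r0 n by [].
  by field.
by rewrite NegzE nonpos.
Qed.

Hypotheses (a_gt0 : forall n, 0 < a n) (c_gt0 : forall n, 0 < c n).

(** One factor is a ratio, hence positive; the other inherits its sign from the product a_n > 0. *)
Lemma st_xt_gt0 n : 0 < st a c r0 n /\ 0 < xt a c r0 n.
Proof.
have sx : 0 < st a c r0 n * xt a c r0 n by rewrite st_mul_xt.
case: n sx => n sx.
  have s_gt0 : 0 < st a c r0 n by rewrite st_nonneg.
  by move: sx; rewrite pmulr_rgt0.
have x_gt0 : 0 < xt a c r0 (Negz n).
  by rewrite (_ : Negz n = - n%:Z - 1) ?xt_neg //; lia.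
by move: sx; rewrite pmulr_lgt0.
Qed.

Lemma rt_yt_gt0 n : 0 < rt a c r0 n /\ 0 < yt a c r0 (n - 1).
Proof.
have ry : 0 < rt a c r0 n * yt a c r0 (n - 1) by rewrite rt_mul_yt.
have [n_le0|n_gt0] := lerP n 0.
  have r_gt0 : 0 < rt a c r0 n.
    by rewrite (_ : n = - `|n|%N%:Z) ?rt_nonpos //; lia.
  by move: ry; rewrite pmulr_rgt0.
have y_gt0 : 0 < yt a c r0 (n - 1).
  by rewrite (_ : n - 1 = `|n - 1|%N%:Z) ?yt_nonneg //; lia.
by move: ry; rewrite pmulr_lgt0.
Qed.

End LU.

(** Stochasticity makes the ratios nonnegative and well-definedness makes them nonzero. Conversely,
    positive ratios make every coefficient positive and validate the product identities. *)
Lemma LU_stochasticP (R : realType) (a b c : int -> R) (r0 : R) :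
  (forall n, a n + b n + c n = 1) ->
  (forall n, 0 < a n) -> (forall n, 0 < c n) ->
  (LU_factorization a b c r0 /\
   stochastic (PL a c r0) /\ stochastic (PU a c r0)) <->
  (forall n, 0 < cf_ratio (qH a c) (1 - r0) n) /\
  (forall n, 0 < cf_ratio (qH' a c) r0 n).
Proof.
move=> abc a_gt0 c_gt0; split.
  move=> [[/LU_well_definedP[rho0 rho'0] _] [[L_ge0 _] [U_ge0 _]]].
  have [||||rho_ge0 rho'_ge0] := @LU_ge0_ratio _ a c r0.
  - by move=> n; have := L_ge0 n n; rewrite /PL /lower_bidiagonal eqxx.
  - by move=> n; have := U_ge0 n n; rewrite /PU /upper_bidiagonal eqxx.
  - move=> n; have := L_ge0 n (n - 1); rewrite /PL /lower_bidiagonal eqxx.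
    by rewrite ifF //; lia.
  - move=> n; have := U_ge0 n (n + 1); rewrite /PU /upper_bidiagonal eqxx.
    by rewrite ifF //; lia.
  by split=> n; rewrite lt_neqAle eq_sym ?rho0 ?rho'0 /=.
move=> [rho_gt0 rho'_gt0].
have aE := st_mul_xt _ _ _ rho_gt0 rho'_gt0.
have cE := rt_mul_yt _ _ _ rho_gt0 rho'_gt0.
have sx := st_xt_gt0 _ _ _ rho_gt0 rho'_gt0 a_gt0.
have ry := rt_yt_gt0 _ _ _ rho_gt0 rho'_gt0 c_gt0.
split; [split|split].
- by apply/LU_well_definedP; split=> n; rewrite gt_eqF.
- apply: mulmxZ_bidiagonal => n //.
  (* The diagonal identity follows from b_n = 1 - a_n - c_n once y_n and x_(n-1) are eliminated: r_n
     + s_n - s_n x_n - r_n y_(n-1) remains. *)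
  have := abc n; rewrite -aE -cE.
  have -> : yt a c r0 n = 1 - xt a c r0 n by rewrite -(yt_add_xt a c r0 n) addrK.
  have -> : xt a c r0 (n - 1) = 1 - yt a c r0 (n - 1).
    by rewrite -(yt_add_xt a c r0 (n - 1)) addrAC subrr add0r.
  have := rt_add_st a c r0 n; lra.
- apply: lower_bidiagonal_stochastic => n; last exact: rt_add_st.
    by apply/ltW; case: (sx n).
  by apply/ltW; case: (ry n).
- apply: upper_bidiagonal_stochastic => n; last exact: yt_add_xt.
    by apply/ltW; have [_] := ry (n + 1); rewrite addrK.
  by apply/ltW; case: (sx n).
Qed.

(** * Convergence of H and H', and the admissible range of the parameter *)

Theorem theorem2p2 (R : realType) (a b c : int -> R)
  (habc : forall n : int, a n + b n + c n = 1)
  (hb : forall n : int, 0 <= b n)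
  (ha : forall n : int, 0 < a n < 1)
  (hc : forall n : int, 0 < c n < 1)
  (hAB : forall n : nat, (1 <= n)%N -> 0 < cfA a c n < cfB a c n)
  (hAB' : forall n : nat, (1 <= n)%N -> 0 < cfA' a c n < cfB' a c n) :
  cvgn (cfh a c) /\ cvgn (cfh' a c) /\
  (limn (cfh' a c) <= limn (cfh a c) ->
   forall r0 : R,
     (LU_factorization a b c r0 /\
      stochastic (PL a c r0) /\ stochastic (PU a c r0)) <->
     limn (cfh' a c) <= r0 <= limn (cfh a c)).
Proof.
have a_gt0 n : 0 < a n by case/andP: (ha n).
have c_gt0 n : 0 < c n by case/andP: (hc n).
have q_gt0 n : 0 < qH a c n by rewrite /qH; case: ifP.
have q'_gt0 n : 0 < qH' a c n by rewrite /qH'; case: ifP.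
have B_gt0 n : 0 < cfB a c n.
  by case: n => [|n]; [exact: ltr01 | case/andP: (hAB n.+1 isT); exact: lt_trans].
have B'_gt0 n : 0 < cfB' a c n.
  by case: n => [|n]; [exact: ltr01 | case/andP: (hAB' n.+1 isT); exact: lt_trans].
have [n||h_cvg h_lim] := @decreasing_bounded_cvgn _ (cfh a c) 0.
- exact: convergents_decreasing.
- case=> [|n]; first by rewrite divr_ge0.
  by case/andP: (hAB n.+1 isT) => A_gt0 _; rewrite divr_ge0 ?ltW.
(* Changing the sign of A' makes the first initial value 1 > 0, so that [convergents_decreasing]
   applies to -h'. *)
have A'E n : - cfA' a c n = (three_term (qH' a c) 1 0 n).2.
  have := three_term_lin (qH' a c) (-1) 0 (-1) 0 0 0 n.
  by rewrite !mul0r !mulr0 !addr0 mulrNN mulr1 mulN1r.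
(* The bound -1 comes from A' < B'. Index 0, outside the range of [hAB'], is separate: h'_0 = 0. *)
have [n|[|n]|hN_cvg hN_lim] := @decreasing_bounded_cvgn _ (- cfh' a c) (-1).
- rewrite /= !fctE /cfh' -!mulNr !A'E.
  exact: convergents_decreasing.
- by rewrite fctE lerN2 /cfh' /cfA' /= mul0r ler01.
- case/andP: (hAB' n.+1 isT) => _ A_lt.
  by rewrite fctE lerN2 ler_pdivrMr // mul1r ltW.
have h'_cvg : cvgn (cfh' a c) by rewrite -is_cvgNE.
split=> //; split=> // _ r0.
rewrite LU_stochasticP // !cf_ratio_gt0P.
(* The initial pair splits as (1, 1 - r0) = (1, 1) - r0 (0, 1), which gives A_n - r0 B_n by
   linearity. *)
have NE n : (0 < (three_term (qH a c) 1 (1 - r0) n).2) = (r0 < cfh a c n).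
  have := three_term_lin (qH a c) 1 (- r0) 1 1 0 1 n.
  rewrite !mulr1 mulr0 addr0 mul1r => ->.
  by rewrite /cfh ltr_pdivlMr // mulNr subr_gt0.
(* Here (1, r0) = (1, 0) + r0 (0, 1) gives r0 B' - A'. The inequality is stated with negated sides
   to match [hN_lim]. *)
have N'E n : (0 < (three_term (qH' a c) 1 r0 n).2) = (- r0 < (- cfh' a c) n).
  have := three_term_lin (qH' a c) 1 r0 1 0 0 1 n.
  rewrite !mulr1 !mulr0 addr0 add0r mul1r -A'E addrC => ->.
  by rewrite fctE ltrN2 /cfh' ltr_pdivrMr // subr_gt0.
under eq_forall do rewrite NE.
under [X in _ /\ X]eq_forall do rewrite N'E.
rewrite h_lim hN_lim limN // lerN2.
by rewrite andbC; split=> [[-> ->]|/andP].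
Qed.
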